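(* Let $n\ge 1$, let $N$ be a multiplicative, unitarily invariant, self-adjoint norm on $\mathbb{M}_n$, and let $\alpha_1,\alpha_2\in[0,\pi/2)$. If $X\in\mathbb{M}^s_{n,\alpha_1}$ and $Y\in\mathbb{M}^s_{n,\alpha_2}$, then $$\omega_N(XY)\le \sec(\alpha_1)\sec(\alpha_2)\,\omega_N(X)\,\omega_N(Y).$$
   Context: $\mathbb{M}_n$ is the algebra of $n\times n$ complex matrices. A norm $N$ on $\mathbb{M}_n$ is multiplicative if $N(XY)\le N(X)N(Y)$ for all $X,Y\in\mathbb{M}_n$; unitarily invariant if $N(UXV)=N(X)$ for all $X\in\mathbb{M}_n$ and all unitary $U,V\in\mathbb{M}_n$; self-adjoint if $N(X^* )=N(X)$ for all $X$. With $\operatorname{Re}(X)=\frac{X+X^*}{2}$, the generalized numerical radius induced by $N$ is $\omega_N(X)=\sup_{\theta\in\mathbb{R}}N(\operatorname{Re}(e^{i\theta}X))$. The numerical range of $X$ is $W(X)=\{\langle Xx,x\rangle: x\in\mathbb{C}^n,\ \|x\|=1\}$. For $\alpha\in[0,\pi/2)$, $S_\alpha=\{x+iy\in\mathbb{C}: x>0,\ |y|\le \tan(\alpha)\,x\}$, and $\mathbb{M}^s_{n,\alpha}$ is the class of all $X\in\mathbb{M}_n$ for which there is a complex number $z$ with $|z|=1$ and $W(zX)\subset S_\alpha$. *)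

(* Defs.v *)
From HB Require Import structures.
From mathcomp Require Import all_boot all_order all_algebra.
From mathcomp Require Import spectral sesquilinear.
From mathcomp Require Import complex.
From mathcomp Require Import all_classical all_reals all_analysis.

Set Implicit Arguments.
Unset Strict Implicit.
Unset Printing Implicit Defensive.

Import Order.TTheory GRing.Theory Num.Theory.

Local Open Scope ring_scope.
Local Open Scope classical_set_scope.
Local Open Scope sesquilinear_scope.
Local Open Scope complex_scope.

Notation normc := Normc.normc.

Section Norms.
Context {R : realType} {n : nat}.
Implicit Types (N : 'M[R[i]]_n -> R) (X Y U V : 'M[R[i]]_n).

(* Nonnegativity is a consequence of these axioms. *)
Record is_norm N : Prop := IsNorm {
  norm_triangle : forall X Y, N (X + Y) <= N X + N Y ;
  norm_homogeneous : forall (c : R[i]) X, N (c *: X) = normc c * N X ;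
  norm_definite : forall X, N X = 0 -> X = 0 }.

Definition multiplicative_norm N := forall X Y, N (X *m Y) <= N X * N Y.

Definition unitarily_invariant N :=
  forall X U V, U \is unitarymx -> V \is unitarymx -> N (U *m X *m V) = N X.

Definition selfadjoint_norm N := forall X, N (X ^t*) = N X.

End Norms.

Section NumericalRadius.
Context {R : realType} {n : nat}.
Implicit Types (N : 'M[R[i]]_n -> R) (X : 'M[R[i]]_n) (x y : 'cV[R[i]]_n).

Definition expi (theta : R) : R[i] := cos theta +i* sin theta.

Definition Remx X : 'M[R[i]]_n := 2%:R^-1 *: (X + X ^t*).

(* [sup] is the real-valued supremum of the library, 0 on unbounded sets; for
   a norm the set below is nonempty and bounded, see [omega_has_sup]. *)
Definition omega N X : R := sup (range (fun theta : R => N (Remx (expi theta *: X)))).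

Definition inner x y : R[i] := (y ^t* *m x) 0 0.

Definition norm2 x : R := Num.sqrt (complex.Re (inner x x)).

Definition numerical_range X : set R[i] :=
  [set inner (X *m x) x | x in [set x | norm2 x = 1]].

Definition sector (alpha : R) : set R[i] :=
  [set z | 0 < complex.Re z /\ `|complex.Im z| <= tan alpha * complex.Re z].

Definition sectorial (alpha : R) X : Prop :=
  exists z : R[i], normc z = 1 /\ numerical_range (z *: X) `<=` sector alpha.

End NumericalRadius.

Definition sec {R : realType} (a : R) : R := (cos a)^-1.

Lemma normc_expi (R : realType) (theta : R) : normc (expi theta) = 1.
Proof. by rewrite /= cos2Dsin2 sqrtr1. Qed.

Lemma omega_has_sup (R : realType) (n : nat) (N : 'M[R[i]]_n -> R)
  (X : 'M[R[i]]_n) :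
  is_norm N -> has_sup (range (fun theta : R => N (Remx (expi theta *: X)))).
Proof.
move=> [tri hom _]; split; first by exists (N (Remx (expi 0 *: X))), 0.
exists (normc 2%:R^-1 * (N X + N (X ^t* ))) => _ [theta _ <-].
have normc_ge0 (c : R[i]) : 0 <= normc c by case: c => a b; exact: sqrtr_ge0.
rewrite /Remx hom ler_wpM2l//; apply: le_trans (tri _ _) _.
rewrite linearZ /= map_mxZ !hom normc_expi mul1r lerD2l.
by rewrite /= sqrrN cos2Dsin2 sqrtr1 mul1r.
Qed.

(* Main.v *)
(* Since N is self-adjoint and multiplicative, omega(XY) <= N(XY) <= N(X) N(Y),
   so it suffices that cos(alpha) N(X) <= N(Re X) when W(X) lies in S_alpha.
   Such an X is invertible; let P X V^* = diag(sigma) be a singular value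
   decomposition, with w_j, v_j the singular vectors, sigma_j = <X w_j, v_j>.
   With A = Re X and B = Im X, the forms sin(alpha) A +/- cos(alpha) B are
   positive semidefinite; evaluating them at w - e^{-/+ i alpha} v gives, when
   alpha > 0 (for alpha = 0, B vanishes),
     2 cos(alpha) Re <X w, v> <= <A w, w> + <A v, v>,
   so that 2 cos(alpha) sigma_j is at most the j-th diagonal entry of
   M = V A V^* + P A P^*, whence 2 cos(alpha) N(X) <= N(M) <= 2 N(A):
   contractive real diagonal factors and passing to the diagonal part are
   both averages of multiplications by unitaries. *)
Require Import Defs.
From mathcomp Require Import all_boot all_order all_algebra.
From mathcomp Require Import spectral sesquilinear ring lra.
From mathcomp Require Import complex.
From mathcomp Require Import all_classical all_reals all_analysis.

Import Order.TTheory GRing.Theory Num.Theory.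
Local Open Scope ring_scope.
Local Open Scope sesquilinear_scope.
Local Open Scope complex_scope.

(** * Pinching to the diagonal as a sequence of averages *)

Section Pinching.
Context {K : comNzRingType} {n : nat}.
Implicit Type X : 'M[K]_n.

(** Interpolates between [X] and its diagonal part, clearing one index at a time so that each step
    averages only two matrices. *)
Definition partial_pinching X m : 'M[K]_n :=
  \matrix_(i, j) (if (i != j) && ((i < m)%N || (j < m)%N) then 0 else X i j).

Lemma partial_pinching0 X : partial_pinching X 0 = X.
Proof. by apply/matrixP => i j; rewrite !mxE andbF. Qed.

Lemma partial_pinching_diag X : partial_pinching X n = diag_mx (\row_j X j j).
Proof.
apply/matrixP => i j; rewrite !mxE ltn_ord andbT.
by case: eqVneq => [->|].
Qed.

Definition sign_flip m : 'rV[K]_n :=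
  \row_j (-1) ^+ nat_of_bool (j == m :> nat).

(** Conjugation by [sign_flip m] negates the off-diagonal entries of row and column [m] and fixes
    all others, so the mean clears exactly those entries. *)
Lemma partial_pinchingS X m : partial_pinching X m.+1 *+ 2 =
  partial_pinching X m
    + diag_mx (sign_flip m) *m partial_pinching X m *m diag_mx (sign_flip m).
Proof.
apply/matrixP => i j; rewrite mulr2n mul_mx_diag mul_diag_mx !mxE !ltnS.
case: (eqVneq i j) => [->|ij] /=.
  by rewrite mulrAC -expr2 sqrr_sign mul1r.
rewrite (leq_eqVlt i m) (leq_eqVlt j m).
(* Off the diagonal, at most one of the two sign factors is [-1]. *)
have : ~~ ((i == m :> nat) && (j == m :> nat)).
  apply/negP => /andP[/eqP im /eqP jm].
  by rewrite -(inj_eq val_inj) /= im jm eqxx in ij.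
by case: (i == m :> nat); case: (j == m :> nat); case: (i < m)%N; case: (j < m)%N
  => //= _; ring.
Qed.

End Pinching.

Lemma diag_unitary {R : realType} m (d : 'rV[R[i]]_m) :
  (forall j, normc (d 0 j) = 1) -> diag_mx d \is unitarymx.
Proof.
move=> d1; apply/unitarymxP; rewrite tr_diag_mx map_diag_mx mulmx_diag.
apply/matrixP => i j; rewrite !mxE; case: eqP => //= _; rewrite !mulr1n.
rewrite -normCK; apply: etrans (expr1n _ 2); congr (_ ^+ 2).
apply: etrans (normc_def _) _; apply: (congr1 (real_complex R)).
by case: (d 0 _) (d1 i) => a b.
Qed.

(** * Averaging inequalities for unitarily invariant norms *)

Section Norm.
Context {R : realType} {n : nat} {N : 'M[R[i]]_n -> R}.
Hypothesis normN : is_norm N.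
Implicit Types (X Y Z D : 'M[R[i]]_n).

Lemma norm_mulrn X m : N (X *+ m) = N X *+ m.
Proof.
rewrite -scaler_nat norm_homogeneous// normcMn.
by rewrite Normc.normc1 mulr_natl.
Qed.

Lemma norm_average X Y Z : Z *+ 2 = X + Y -> N Z *+ 2 <= N X + N Y.
Proof. by move=> ZXY; rewrite -norm_mulrn ZXY norm_triangle. Qed.

Lemma norm_ge0 X : 0 <= N X.
Proof.
have : N (0 *+ 2) <= N X + N (- X).
  by rewrite mul0rn -[X in N X <= _](subrr X) norm_triangle.
rewrite norm_mulrn -scaleN1r norm_homogeneous// normcN Normc.normc1 mul1r.
rewrite -(scale0r X) norm_homogeneous// Normc.normc0 mul0r mul0rn.
lra.
Qed.

Lemma norm_scale_real (a : R) X : 0 <= a -> N (a%:C *: X) = a * N X.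
Proof.
by move=> a0; rewrite norm_homogeneous//= expr0n addr0 sqrtr_sqr ger0_norm.
Qed.

Lemma norm_Remx X : selfadjoint_norm N -> N (Remx X) <= N X.
Proof.
move=> saN; have /norm_average : Remx X *+ 2 = X + X ^t*.
  by rewrite -scaler_nat scalerA divff ?scale1r// pnatr_eq0.
rewrite saN; lra.
Qed.

Lemma norm_unimodular (z : R[i]) X : normc z = 1 -> N (z *: X) = N X.
Proof. by move=> z1; rewrite norm_homogeneous// z1 mul1r. Qed.

Section UnitarilyInvariant.
Hypothesis uiN : unitarily_invariant N.

Lemma norm_mull_unitary U X : U \is unitarymx -> N (U *m X) = N X.
Proof.
move=> Uu; have := uiN X U 1%:M Uu; rewrite mulmx1; apply.
by apply/unitarymxP; rewrite trmx1 map_mx1 mulmx1.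
Qed.

(* A real number of [[-1, 1]] is the mean of two conjugate unimodular numbers. *)
Lemma norm_diag_contraction (t : 'I_n -> R) D : (forall j, `|t j| <= 1) ->
  N (diag_mx (\row_j (t j)%:C) *m D) <= N D.
Proof.
move=> t1.
pose u b := \row_j
  (t j +i* ((-1) ^+ nat_of_bool b * Num.sqrt (1 - t j ^+ 2))).
have t2 j : 0 <= 1 - t j ^+ 2.
  by rewrite subr_ge0 -real_normK ?num_real // exprn_ile1.
have uu b : diag_mx (u b) \is unitarymx.
  apply: diag_unitary => j; rewrite mxE /=.
  rewrite exprMn sqrr_sign sqr_sqrtr// mul1r.
  by rewrite addrC subrK sqrtr1.
have /norm_average : diag_mx (\row_j (t j)%:C) *m D *+ 2 =
    diag_mx (u false) *m D + diag_mx (u true) *m D.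
  rewrite mulr2n -!mulmxDl; congr (_ *m _).
  rewrite -!linearD /=; congr diag_mx; apply/rowP => j; rewrite !mxE.
  by apply/eqP; rewrite eq_complex /=; apply/andP; split; apply/eqP; ring.
rewrite !(norm_mull_unitary _ _ (uu _)); lra.
Qed.

Lemma norm_partial_pinching X m : N (partial_pinching X m) <= N X.
Proof.
elim: m => [|m]; first by rewrite partial_pinching0.
apply: le_trans; have /norm_average := partial_pinchingS X m.
have fu : diag_mx (sign_flip m) \is @unitarymx R[i] n n.
  apply: diag_unitary => j; rewrite mxE; case: (_ == _);
  by rewrite ?expr1 ?normcN Normc.normc1.
rewrite uiN//; lra.
Qed.

Lemma norm_pinching X : N (diag_mx (\row_j X j j)) <= N X.
Proof.
by rewrite -partial_pinching_diag norm_partial_pinching.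
Qed.

End UnitarilyInvariant.
End Norm.

(* Here [gr +i* gi], [hr +i* hi] are the values [<X w, v>], [<X v, w>] of a form,
   and [A x y], [B x y] the real and imaginary parts of its value at
   [w - (x +i* y) v]. *)
Lemma sector_cross_real (K : realFieldType) (c s ar ai br bi gr gi hr hi : K)
    (A := fun x y => ar + (x ^+ 2 + y ^+ 2) * br - (x * gr + y * gi) - (x * hr - y * hi))
    (B := fun x y => ai + (x ^+ 2 + y ^+ 2) * bi - (x * gi - y * gr) - (x * hi + y * hr)) :
  0 < c -> 0 <= s -> c ^+ 2 + s ^+ 2 = 1 ->
  `|c * ai| <= s * ar -> `|c * bi| <= s * br ->
  (forall x y, `|c * B x y| <= s * A x y) -> (forall x y, 0 <= A x y) ->
  2 * c * gr <= ar + br.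
Proof.
(* For [s = 0] one cannot cancel [s], but [B] vanishes identically: [B 0 1 = 0] gives [gr = hr], and
   then [0 <= A 1 0] is the claim. *)
move=> c0; rewrite le_eqVlt => /orP[/eqP <-|s0] cs.
  have c1 : c = 1 by move: cs; rewrite expr0n addr0; nra.
  rewrite c1 !mul0r !mul1r !normr_le0 => /eqP ai0 /eqP bi0 AB A0.
  have := A0 1 0; have := AB 0 1; rewrite mul0r mul1r normr_le0 => /eqP.
  rewrite /A /B ai0 bi0; lra.
move=> _ _ AB _; rewrite -subr_ge0 -(pmulr_rge0 _ s0).
(* Adding the upper bound on [B] at [(c, s)] to the lower bound at [(c, - s)] cancels [ai], [bi],
   [gi], [hr] and [hi]. *)
have := AB c (- s); have := AB c s; rewrite !ler_norml => /andP[_ le1] /andP[le2 _].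
have := lerD le1 le2; rewrite -subr_ge0 /A /B sqrrN cs.
set e := (X in 0 <= X -> _); suff -> : e = 2 * (s * (ar + br - 2 * c * gr)) by lra.
by rewrite /e; ring.
Qed.

(** * Quadratic forms with values in a sector *)

Section Form.
Context {R : realType} {n : nat}.
Implicit Types (X : 'M[R[i]]_n) (v w x : 'cV[R[i]]_n) (a : R[i]).

Lemma inner_scale X x a :
  inner (X *m (a *: x)) (a *: x) = conjc a * a * inner (X *m x) x.
Proof.
rewrite /inner linearZ /= map_mxZ -scalemxAr -!scalemxAl -scalemxAr !mxE.
exact: mulrA.
Qed.

Lemma inner_sub X w v a :
  inner (X *m (w - a *: v)) (w - a *: v) =
  inner (X *m w) w + conjc a * a * inner (X *m v) v
    - conjc a * inner (X *m w) v - a * inner (X *m v) w.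
Proof.
rewrite /inner; have -> : (w - a *: v) ^t* = w ^t* - conjc a *: v ^t*.
  by apply/rowP => k; rewrite !mxE rmorphB rmorphM.
rewrite !mulmxBr !mulmxBl -!scalemxAr -!scalemxAl.
set ww := w ^t* *m _; set vv := v ^t* *m _; set wv := v ^t* *m _; set vw := w ^t* *m _.
by rewrite !mxE; ring.
Qed.

Lemma inner_sub_ReIm X w v (x y : R) :
  complex.Re (inner (X *m (w - (x +i* y) *: v)) (w - (x +i* y) *: v)) =
    complex.Re (inner (X *m w) w) + (x ^+ 2 + y ^+ 2) * complex.Re (inner (X *m v) v)
      - (x * complex.Re (inner (X *m w) v) + y * complex.Im (inner (X *m w) v))
      - (x * complex.Re (inner (X *m v) w) - y * complex.Im (inner (X *m v) w)) /\
  complex.Im (inner (X *m (w - (x +i* y) *: v)) (w - (x +i* y) *: v)) =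
    complex.Im (inner (X *m w) w) + (x ^+ 2 + y ^+ 2) * complex.Im (inner (X *m v) v)
      - (x * complex.Im (inner (X *m w) v) - y * complex.Re (inner (X *m w) v))
      - (x * complex.Im (inner (X *m v) w) + y * complex.Re (inner (X *m v) w)).
Proof.
rewrite inner_sub; move: (inner (X *m w) w) (inner (X *m v) v).
move: (inner (X *m w) v) (inner (X *m v) w) => [? ?] [? ?] [? ?] [? ?] /=.
by split; ring.
Qed.

Lemma Re_inner_gt0 x : x != 0 -> 0 < complex.Re (inner x x).
Proof.
move=> x0; have : x^t* != 0.
  by apply: contra_neq x0 => xt0; rewrite -(trmxCK x) xt0 trmx0 map_mx0.
move=> /dotmx_is_dotmx; rewrite dotmxE trmxCK ltcE => /andP[_]; exact.
Qed.

(** Normalizing [x] multiplies the form by the positive real [r ^- 2], and the sector is a cone. *)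
Lemma sectorial_form_gt0 {alpha : R} {X x} :
  (numerical_range X `<=` sector alpha)%classic -> x != 0 ->
  0 < complex.Re (inner (X *m x) x) /\
  `|complex.Im (inner (X *m x) x)| <= tan alpha * complex.Re (inner (X *m x) x).
Proof.
move=> Xa x0; have i0 := Re_inner_gt0 x x0.
pose r := norm2 x; have r0 : 0 < r by rewrite sqrtr_gt0.
have r2 : r ^+ 2 = complex.Re (inner x x) by rewrite sqr_sqrtr// ltW.
have eC (z : R[i]) : conjc (r^-1)%:C * (r^-1)%:C * z = (r ^- 2)%:C * z.
  by rewrite conjc_real -rmorphM -expr2 exprVn.
have eRe (b : R) (z : R[i]) : complex.Re (b%:C * z) = b * complex.Re z.
  by case: z => /= *; rewrite mul0r subr0.
have eIm (b : R) (z : R[i]) : complex.Im (b%:C * z) = b * complex.Im z.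
  by case: z => /= *; rewrite mul0r addr0.
have := Xa (inner (X *m ((r^-1)%:C *: x)) ((r^-1)%:C *: x)).
rewrite inner_scale eC /sector /=.
have r20 : 0 < r ^- 2 by rewrite invr_gt0 exprn_gt0.
rewrite eRe eIm pmulr_rgt0// normrM (gtr0_norm r20) mulrCA ler_pM2l//.
apply; exists ((r^-1)%:C *: x); last by rewrite inner_scale eC.
rewrite /= /norm2 -[X in inner X _]mul1mx inner_scale eC mul1mx eRe -r2 mulVf ?sqrtr1//.
by rewrite expf_neq0// gt_eqF.
Qed.

Lemma sectorial_form_ge0 {alpha : R} {X} :
  (numerical_range X `<=` sector alpha)%classic -> forall x,
  `|complex.Im (inner (X *m x) x)| <= tan alpha * complex.Re (inner (X *m x) x)
  /\ 0 <= complex.Re (inner (X *m x) x).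
Proof.
move=> Xa x; have [->|/(sectorial_form_gt0 Xa)[/ltW]//] := eqVneq x 0.
by rewrite /inner !mulmx0 mxE normr0 mulr0.
Qed.

(** A nonzero kernel vector would give the form the value 0, whose real part is not positive. *)
Lemma sectorial_unitmx {alpha : R} {X} :
  (numerical_range X `<=` sector alpha)%classic -> X \in unitmx.
Proof.
move=> Xa; rewrite -unitmx_tr -row_free_unit -kermx_eq0.
apply/negPn/negP => /rowV0Pn[u /sub_kermxP uX u0].
have [|] := @sectorial_form_gt0 alpha X (u^T) Xa.
  by rewrite -trmx0 (inj_eq trmx_inj).
by rewrite -[X]trmxK -trmx_mul uX trmx0 /inner mulmx0 mxE ltxx.
Qed.

Lemma sectorial_cross_le {alpha : R} {X} : 0 <= alpha < pi / 2 ->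
  (numerical_range X `<=` sector alpha)%classic -> forall w v,
  2 * cos alpha * complex.Re (inner (X *m w) v) <=
  complex.Re (inner (X *m w) w) + complex.Re (inner (X *m v) v).
Proof.
move=> /andP[a0 api] /sectorial_form_ge0 Xa w v.
have c0 : 0 < cos alpha by rewrite cos_gt0_pihalf// api andbT; lra.
(* The sector bound with the denominator of [tan alpha] cleared. *)
have Xsec x : `|cos alpha * complex.Im (inner (X *m x) x)|
    <= sin alpha * complex.Re (inner (X *m x) x).
  rewrite normrM gtr0_norm// -ler_pdivlMl// mulrA [_^-1 * _]mulrC.
  exact: (Xa x).1.
have s0 : 0 <= sin alpha by apply: sin_ge0_pi; rewrite a0 /=; have := pi_gt0 R; lra.
apply: (@sector_cross_real _ (cos alpha) (sin alpha)
  _ (complex.Im (inner (X *m w) w)) _ (complex.Im (inner (X *m v) v))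
  _ (complex.Im (inner (X *m w) v)) (complex.Re (inner (X *m v) w))
  (complex.Im (inner (X *m v) w)) c0 s0 (cos2Dsin2 _) (Xsec w) (Xsec v)) => x y.
  by rewrite -(inner_sub_ReIm X w v x y).1 -(inner_sub_ReIm X w v x y).2.
by rewrite -(inner_sub_ReIm X w v x y).1; exact: (Xa _).2.
Qed.

End Form.

(** * Singular value decomposition and diagonal entries as forms *)

Section Svd.
Context {R : realType} {n : nat}.
Implicit Types (X P V : 'M[R[i]]_n).

Lemma mul_adjoint_diag X j : (X *m X ^t*) j j =
  (\sum_k (complex.Re (X j k) ^+ 2 + complex.Im (X j k) ^+ 2))%:C.
Proof.
rewrite mxE rmorph_sum; apply: eq_bigr => k _; rewrite !mxE.
case: (X j k) => a b; apply/eqP; rewrite eq_complex /=.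
by apply/andP; split; apply/eqP; ring.
Qed.

(** The spectral theorem for [X *m X ^t*] provides [P]. The rows of [P *m X] are then orthogonal,
    with the eigenvalues as squared lengths, and [V] is made of these rows normalized. *)
Lemma invertible_svd X : X \in unitmx -> exists P V (sigma : 'I_n -> R),
  [/\ P \is unitarymx, V \is unitarymx, forall j, 0 <= sigma j &
   P *m X *m V ^t* = diag_mx (\row_j (sigma j)%:C)].
Proof.
move=> Xu; pose H := X *m X ^t*.
have /orthomx_spectralP : H \is normalmx.
  by apply/normalmxP; rewrite /H trmx_mul map_mxM trmxCK.
set P := spectralmx H; set d := spectral_diag H.
have Pu : P \is unitarymx by exact: spectral_unitarymx.
rewrite (invmx_unitary Pu) => HE; pose Y := P *m X.
have YY : Y *m Y ^t* = diag_mx d.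
  rewrite /Y trmx_mul map_mxM mulmxA -(mulmxA P) -/H HE !mulmxA.
  by rewrite mulmxtVK// (unitarymxP Pu) mul1mx.
pose rho j := \sum_k (complex.Re (Y j k) ^+ 2 + complex.Im (Y j k) ^+ 2).
have dE j : d 0 j = (rho j)%:C.
  by rewrite -mul_adjoint_diag YY mxE eqxx mulr1n.
have rho_ge0 j : 0 <= rho j by apply: sumr_ge0 => k _; rewrite addr_ge0 ?sqr_ge0.
(* Invertibility of [X] enters here: it allows division by [sigma j]. *)
have rho_neq0 j : rho j != 0.
  have : diag_mx d \in unitmx.
    by rewrite -YY unitmx_mul map_unitmx unitmx_tr andbb unitmx_mul unitarymx_unit.
  rewrite unitmxE unitfE det_diag => /prodf_neq0/(_ j isT).
  by rewrite dE; apply: contra_neq => ->.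
pose sigma j := Num.sqrt (rho j).
have sigma_neq0 j : sigma j != 0 by rewrite sqrtr_eq0 -ltNge lt_neqAle eq_sym rho_neq0 rho_ge0.
pose V := diag_mx (\row_j ((sigma j)^-1)%:C) *m Y.
have VE : V ^t* = Y ^t* *m diag_mx (\row_j ((sigma j)^-1)%:C).
  rewrite /V trmx_mul map_mxM tr_diag_mx map_diag_mx; congr (_ *m diag_mx _).
  by apply/rowP => j; rewrite !mxE; exact: conjc_real.
exists P, V, sigma; split; [exact: Pu| |by move=> j; exact: sqrtr_ge0|].
- apply/unitarymxP; rewrite VE /V mulmxA -(mulmxA _ Y) YY.
  rewrite (mulmx_diag _ d) mulmx_diag.
  apply/matrixP => i j; rewrite !mxE; case: eqP => // _.
  rewrite !mulr1n dE -!rmorphM /=; apply: (congr1 (real_complex R)).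
  rewrite -[rho _]sqr_sqrtr// -/(sigma _) expr2.
  by rewrite mulrA mulVf// mul1r mulfV.
- rewrite VE -/Y mulmxA YY mulmx_diag; congr diag_mx; apply/rowP => j.
  rewrite !mxE dE -rmorphM /= -[rho _]sqr_sqrtr// -/(sigma _) expr2.
  by rewrite mulfK.
Qed.

(** The adjoints of the rows of [V] and [P] serve as the singular vectors [w_j] and [v_j]. *)
Lemma mulmx_adjoint_diag P X V j :
  (P *m X *m V ^t*) j j = inner (X *m (row j V) ^t*) ((row j P) ^t*).
Proof.
rewrite /inner trmxCK mulmxA -row_mul !mxE.
by apply: eq_bigr => k _; rewrite !mxE.
Qed.

Lemma inner_adjoint X (x : 'cV[R[i]]_n) :
  inner (X ^t* *m x) x = conjc (inner (X *m x) x).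
Proof.
rewrite /inner; transitivity ((x ^t* *m (X *m x)) ^t* 0 0).
  by rewrite !trmx_mul !map_mxM trmxCK mulmxA.
by rewrite !mxE.
Qed.

Lemma inner_Remx X (x : 'cV[R[i]]_n) :
  inner (Remx X *m x) x = (complex.Re (inner (X *m x) x))%:C.
Proof.
rewrite /Remx -scalemxAl mulmxDl.
have -> (Y Z : 'cV[R[i]]_n) : inner (2^-1 *: (Y + Z)) x = 2^-1 * (inner Y x + inner Z x).
  by rewrite /inner -scalemxAr mulmxDr !mxE.
by rewrite inner_adjoint addcJ mulKf// pnatr_eq0.
Qed.

End Svd.

(** The angle is [acos a] up to sign, since the sine of [acos a] is the absolute value of [b]. *)
Lemma expi_surj {R : realType} (z : R[i]) :
  normc z = 1 -> exists theta, expi theta = z.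
Proof.
case: z => a b /= ab.
have ab1 : a ^+ 2 + b ^+ 2 = 1.
  by rewrite -(sqr_sqrtr (_ : 0 <= a ^+ 2 + b ^+ 2)) ?ab ?expr1n// addr_ge0 ?sqr_ge0.
have a1 : -1 <= a <= 1 by nra.
have aE : cos (acos a) = a by rewrite acosK// in_itv.
have sE : sin (acos a) = `|b|.
  by rewrite sin_acos// -sqrtr_sqr; congr Num.sqrt; lra.
have [b0|b0] := leP 0 b.
  by exists (acos a); rewrite /expi aE sE ger0_norm.
by exists (- acos a); rewrite /expi cosN sinN aE sE ltr0_norm// opprK.
Qed.

(** * Comparison of the norm with the generalized numerical radius *)

Section SectorialNorm.
Context {R : realType} {n : nat} {N : 'M[R[i]]_n -> R}.
Hypotheses (normN : is_norm N) (uiN : unitarily_invariant N).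

Lemma sectorial_norm_le {alpha : R} {X : 'M[R[i]]_n} : 0 <= alpha < pi / 2 ->
  (numerical_range X `<=` sector alpha)%classic ->
  cos alpha * N X <= N (Remx X).
Proof.
move=> alpha_bd Xa; have /andP[a0 api] := alpha_bd.
have c0 : 0 < cos alpha by rewrite cos_gt0_pihalf// api andbT; lra.
have [P [V [sigma [Pu Vu sigma0 XE]]]] := invertible_svd _ (sectorial_unitmx Xa).
have V'u : V ^t* \is unitarymx by rewrite (trmxC_unitary V); exact: Vu.
have P'u : P ^t* \is unitarymx by rewrite (trmxC_unitary P); exact: Pu.
rewrite -(uiN X P (V ^t*) Pu V'u) XE.
pose q x : R := complex.Re (inner (X *m x) x).
pose m j : R := q ((row j V) ^t*) + q ((row j P) ^t*).
pose M := V *m Remx X *m V ^t* + P *m Remx X *m P ^t*.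
have ME : \row_j M j j = \row_j (m j)%:C.
  apply/rowP => j; rewrite mxE [RHS]mxE.
  by rewrite mxE !mulmx_adjoint_diag !inner_Remx -rmorphD.
have sigma_le j : 2 * cos alpha * sigma j <= m j.
  apply: le_trans (sectorial_cross_le alpha_bd Xa _ _).
  by rewrite -mulmx_adjoint_diag XE !mxE eqxx mulr1n.
(* If [m j = 0], the quotient is 0 by convention; the numerator, squeezed between 0 and [m j], is
   then 0 too, so [tM] still holds. *)
pose t j := 2 * cos alpha * sigma j / m j.
have csigma0 j : 0 <= 2 * cos alpha * sigma j by rewrite !mulr_ge0// ltW.
have m0 j : 0 <= m j := le_trans (csigma0 j) (sigma_le j).
have t1 j : `|t j| <= 1.
  rewrite ger0_norm ?divr_ge0//.
  have [m00|m_neq0] := eqVneq (m j) 0; first by rewrite /t m00 invr0 mulr0.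
  by rewrite ler_pdivrMr ?mul1r// lt_neqAle eq_sym m_neq0 m0.
have tM : (2 * cos alpha)%:C *: diag_mx (\row_j (sigma j)%:C) =
    diag_mx (\row_j (t j)%:C) *m diag_mx (\row_j M j j).
  rewrite ME -linearZ mulmx_diag; congr diag_mx; apply/rowP => j.
  rewrite !mxE -!rmorphM /= /t; congr (_ %:C).
  have [m00|m_neq0] := eqVneq (m j) 0; last by rewrite divfK.
  by rewrite m00 mulr0; apply/eqP; rewrite eq_le csigma0 -m00 sigma_le.
have NM : N M <= N (Remx X) *+ 2.
  apply: le_trans (norm_triangle normN _ _) _.
  by rewrite (uiN _ V _ Vu V'u) (uiN _ P _ Pu P'u).
have DM := le_trans (norm_pinching normN uiN M) NM.
have := le_trans (norm_diag_contraction normN uiN _ _ t1) DM.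
rewrite -tM (norm_scale_real normN); last by rewrite mulr_ge0// ltW.
by rewrite -mulrA mulr_natl ler_pMn2r.
Qed.

Lemma norm_Remx_le_omega X (z : R[i]) : normc z = 1 ->
  N (Remx (z *: X)) <= omega N X.
Proof.
move=> /expi_surj[theta <-].
by apply: ub_le_sup; [case: (omega_has_sup X normN) | exists theta].
Qed.

(** The rotation [z] taking [X] into the sector preserves [N X] and is one of those over which
    [omega] takes the supremum. *)
Lemma sectorial_norm_le_omega {alpha : R} {X} : 0 <= alpha < pi / 2 ->
  sectorial alpha X -> N X <= sec alpha * omega N X.
Proof.
move=> alpha_bd [z [z1 zX]].
have c0 : 0 < cos alpha.
  by move: alpha_bd => /andP[a0 api]; rewrite cos_gt0_pihalf// api andbT; lra.
rewrite /sec ler_pdivlMl// -(norm_unimodular normN z X z1).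
exact: le_trans (sectorial_norm_le alpha_bd zX) (norm_Remx_le_omega _ _ z1).
Qed.

Lemma omega_le_norm X : selfadjoint_norm N -> omega N X <= N X.
Proof.
move=> saN; apply: ge_sup; first by case: (omega_has_sup X normN).
move=> _ [theta _ <-]; apply: le_trans (norm_Remx normN _ saN) _.
by rewrite norm_unimodular// normc_expi.
Qed.

End SectorialNorm.

Theorem theorem2p1 (R : realType) (n : nat) (N : 'M[R[i]]_n -> R)
  (alpha1 alpha2 : R) (X Y : 'M[R[i]]_n) :
  (1 <= n)%N ->
  is_norm N -> multiplicative_norm N -> unitarily_invariant N ->
  selfadjoint_norm N ->
  0 <= alpha1 < pi / 2 -> 0 <= alpha2 < pi / 2 ->
  sectorial alpha1 X -> sectorial alpha2 Y ->
  omega N (X *m Y) <= sec alpha1 * sec alpha2 * omega N X * omega N Y.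
Proof.
move=> _ normN mulN uiN saN a1 a2 Xa Ya.
apply: le_trans (omega_le_norm normN _ saN) _; apply: le_trans (mulN X Y) _.
(* Regroups the bound into one factor for [X] and one for [Y]. *)
rewrite -[_ * sec _ * _]mulrA (mulrC (sec _) (omega N X)) mulrA -mulrA.
apply: ler_pM; rewrite ?(norm_ge0 normN) //.
  exact: (sectorial_norm_le_omega normN uiN a1).
exact: (sectorial_norm_le_omega normN uiN a2).
Qed.
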